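(* Let $X$ be a real Banach space with $\dim X\ge 2$. Then $$\Omega'(X)\le \frac{2}{5}C_{\mathrm{NJ}}(X)+\frac{4}{5}.$$
   Context: For $x,y\in X$, $x$ is isosceles orthogonal to $y$, written $x\perp_I y$, if $\|x+y\|=\|x-y\|$. The constant $\Omega'(X)$ is defined by $$\Omega'(X)=\sup\left\{\frac{\|x+2y\|^2+\|2x+y\|^2}{5\|x+y\|^2}: x,y\in X,\ (x,y)\ne(0,0),\ x\perp_I y\right\}.$$ (If $x\perp_I y$ and $(x,y)\neq(0,0)$ then $x+y\ne0$, so the quotient is defined.) The von Neumann-Jordan constant is $$C_{\mathrm{NJ}}(X)=\sup\left\{\frac{\|x+y\|^2+\|x-y\|^2}{2(\|x\|^2+\|y\|^2)}: x,y\in X,\ (x,y)\ne(0,0)\right\}.$$ *)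

(* Defs.v *)
From mathcomp Require Import all_boot all_order all_algebra.
From mathcomp Require Import all_classical all_reals all_analysis.

Set Implicit Arguments.
Unset Strict Implicit.
Unset Printing Implicit Defensive.

Import Order.TTheory GRing.Theory Num.Theory.
Import numFieldNormedType.Exports.

Local Open Scope classical_set_scope.
Local Open Scope ring_scope.

(* dim X >= n, for a vector space X of possibly infinite dimension. *)
Definition dim_ge (R : realType) (X : lmodType R) (n : nat) : Prop :=
  exists v : 'I_n -> X,
    forall c : 'I_n -> R, \sum_(i < n) c i *: v i = 0 -> forall i, c i = 0.

Definition isosceles_orthogonal (R : realType) (X : normedModType R)
    (x y : X) : Prop :=
  `|x + y| = `|x - y|.

(* The two suprema below are taken in R. On a nonzero space both sets are
   nonempty, and they are always bounded above (by 2 for CNJ, and by 8/5 for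
   Omega', since isosceles orthogonality gives `|x|, `|y| <= `|x + y|), so the
   value of [sup] on unbounded or empty sets plays no role. *)
Definition Omega' (R : realType) (X : normedModType R) : R :=
  sup [set r : R | exists x y : X,
    [/\ (x, y) <> (0, 0), isosceles_orthogonal x y &
        r = (`|x + 2 *: y| ^+ 2 + `|2 *: x + y| ^+ 2)
            / (5 * `|x + y| ^+ 2)]].

Definition CNJ (R : realType) (X : normedModType R) : R :=
  sup [set r : R | exists x y : X,
    (x, y) <> (0, 0) /\
    r = (`|x + y| ^+ 2 + `|x - y| ^+ 2) / (2 * (`|x| ^+ 2 + `|y| ^+ 2))].

(* Main.v *)
Require Import Defs.
From mathcomp Require Import all_boot all_order all_algebra.
From mathcomp Require Import all_classical all_reals all_analysis.
From mathcomp Require Import lra.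

(** Let [x] be isosceles orthogonal to [y] and put [s = `|x + y| = `|x - y|].
    Since [x + 2y = (x + y) + y], the triangle inequality and convexity of the
    square give [`|x + 2y|^2 <= 2 s^2 + 2 `|y|^2], and symmetrically for
    [2x + y]. The parallelogram-type inequality defining CNJ, applied to the
    pair [(x + y, x - y)], gives [`|x|^2 + `|y|^2 <= CNJ s^2]. *)

Import Order.TTheory GRing.Theory Num.Theory.
Import numFieldNormedType.Exports.

Local Open Scope ring_scope.

Lemma sqr_normD_le (R : realType) (X : normedModType R) (x y : X) :
  `|x + y| ^+ 2 <= 2 * (`|x| ^+ 2 + `|y| ^+ 2).
Proof.
apply: (@le_trans _ _ ((`|x| + `|y|) ^+ 2)).
  by rewrite ler_sqr ?nnegrE ?addr_ge0 ?normr_ge0 ?ler_normD.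
have := sqr_ge0 (`|x| - `|y|); lra.
Qed.

Lemma sqr_norm_add_gt0 (R : realType) (X : normedModType R) (x y : X) :
  (x, y) <> (0, 0) -> 0 < `|x| ^+ 2 + `|y| ^+ 2.
Proof.
move=> xy0; rewrite lt0r paddr_eq0 ?sqr_ge0 // !expf_eq0 /= !normr_eq0.
rewrite addr_ge0 ?sqr_ge0 // andbT.
by apply/negP => /andP[/eqP x0 /eqP y0]; apply: xy0; rewrite x0 y0.
Qed.

Lemma CNJ_ge (R : realType) (X : normedModType R) (x y : X) :
  `|x + y| ^+ 2 + `|x - y| ^+ 2 <= 2 * CNJ X * (`|x| ^+ 2 + `|y| ^+ 2).
Proof.
have [[-> ->]|xy0] := pselect ((x, y) = (0, 0)).
  by rewrite addr0 subr0 normr0 expr0n /= addr0 mulr0.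
have N0 := sqr_norm_add_gt0 _ _ _ _ xy0.
suff : (`|x + y| ^+ 2 + `|x - y| ^+ 2) / (2 * (`|x| ^+ 2 + `|y| ^+ 2)) <= CNJ X.
  by rewrite ler_pdivrMr ?mulr_gt0 // mulrCA mulrA.
apply: ub_le_sup; last by exists x, y.
(* The bound 2 comes from [sqr_normD_le] applied to [(u, v)] and to [(u, - v)]. *)
exists 2 => _ [u [v [uv0 ->]]].
have M0 := sqr_norm_add_gt0 _ _ _ _ uv0.
rewrite ler_pdivrMr ?mulr_gt0 //.
have := sqr_normD_le _ _ u v; have := sqr_normD_le _ _ u (- v).
rewrite normrN; lra.
Qed.

Lemma isosceles_orthogonal_CNJ (R : realType) (X : normedModType R) (x y : X) :
  isosceles_orthogonal x y -> `|x| ^+ 2 + `|y| ^+ 2 <= CNJ X * `|x + y| ^+ 2.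
Proof.
move=> xy; have := CNJ_ge _ _ (x + y) (x - y).
have -> : x + y + (x - y) = 2 *: x by rewrite addrACA subrr addr0 scaler_nat.
have -> : x + y - (x - y) = 2 *: y.
  by rewrite opprB addrC addrA subrK scaler_nat mulr2n.
(* Orthogonality merges the two norms on the right: [4 (|x|^2 + |y|^2) <= 4 CNJ s^2]. *)
rewrite -xy !normrZ ger0_norm //; lra.
Qed.

Theorem theorem5p6 (R : realType) (X : completeNormedModType R)
    (hdim : dim_ge X 2) :
  Omega' X <= 2 / 5 * CNJ X + 4 / 5.
Proof.
apply: ge_sup.
  (* [ge_sup] needs a nonempty set: a nonzero vector paired with 0 supplies an element. *)
  have [v vfree] := hdim.
  have v0 : v ord0 <> 0.
    move=> v0; have := vfree (fun i => (i == ord0)%:R).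
    rewrite big_ord_recl big_ord1 v0 scaler0 scale0r addr0.
    by move=> /(_ erefl ord0)/eqP; rewrite oner_eq0.
  eexists; exists (v ord0), 0; split; last by [].
    by case.
  by rewrite /isosceles_orthogonal addr0 subr0.
move=> _ [x [y [xy0 xy ->]]].
have ab := isosceles_orthogonal_CNJ _ _ _ _ xy.
(* If [s = 0], then [ab] forces [x = y = 0]. *)
have s0 : 0 < `|x + y| ^+ 2.
  rewrite lt0r sqr_ge0 andbT; apply/eqP => s0.
  by have := sqr_norm_add_gt0 _ _ _ _ xy0; move: ab; rewrite s0; lra.
rewrite ler_pdivrMr; last by rewrite pmulr_rgt0.
have -> : x + 2 *: y = (x + y) + y by rewrite scaler_nat mulr2n addrA.
have -> : 2 *: x + y = (x + y) + x by rewrite scaler_nat mulr2n addrAC.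
(* The numerator is at most [4 s^2 + 2 (|x|^2 + |y|^2)], hence by [ab] at most [(4 + 2 CNJ) s^2]. *)
have := sqr_normD_le _ _ (x + y) y; have := sqr_normD_le _ _ (x + y) x.
lra.
Qed.
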